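(* Suppose that $A \in \mathbb{C}^{n \times n}$ is a disk matrix with numerical radius $r(A) > 0$, and that its field of values $W(A)$ is approximated by $\mathcal{G}_j$ with $j \geq 3$ and $\mathcal{G}_j$ a regular polygon, i.e., it is the intersection of the $j$ half planes $P_{\theta_\ell}$, where $\theta_\ell = \tfrac{2\pi}{j}\ell$ for $\ell = 1,\ldots,j$. Let $\varepsilon_j$ denote the associated relative error estimate, and let $\tau_{\mathrm{tol}} > 0$ be the desired relative error. Then: (i) $\varepsilon_j = \sec(\pi/j) - 1$; (ii) if $\varepsilon_j \leq \tau_{\mathrm{tol}}$, then $j \geq \left\lceil \dfrac{\pi}{\operatorname{arcsec}(1+\tau_{\mathrm{tol}})} \right\rceil$. Moreover, if $\mathcal{G}_k$ (an intersection of $k$ half planes) is a further refined version of $\mathcal{G}_j$ obtained by Uhlig's cutting procedure, so that $W(A) \subseteq \mathcal{G}_k \subseteq \mathcal{G}_j$, then: (iii) if $\varepsilon_k < \varepsilon_j$, then $k \geq 2j$; (iv) if $\varepsilon_k \leq \tau_{\mathrm{tol}} < \varepsilon_j$, then $k \geq j \cdot 2^d$, where $d = \left\lceil \log_2\left( \dfrac{\pi}{j \operatorname{arcsec}(1+\tau_{\mathrm{tol}})} \right) \right\rceil$.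
   Context: For $A \in \mathbb{C}^{n\times n}$, the field of values is $W(A) = \{x^*Ax : x \in \mathbb{C}^n, \|x\|=1\}$ and the numerical radius is $r(A) = \max\{|z| : z \in W(A)\}$. A disk matrix is a matrix whose field of values is a circular disk centered at the origin. For $\theta \in \mathbb{R}$ let $H(\theta) = \tfrac12(e^{\mathbf{i}\theta}A + e^{-\mathbf{i}\theta}A^* )$, let $\lambda_\theta$ be the largest eigenvalue of $H(\theta)$, and let $x_\theta$ be an associated normalized eigenvector. Let $L_\theta = \{e^{-\mathbf{i}\theta}(\lambda_\theta + \mathbf{i}t) : t \in \mathbb{R}\}$ (a supporting hyperplane of $W(A)$), $P_\theta = e^{-\mathbf{i}\theta}\{z \in \mathbb{C} : \operatorname{Re} z \leq \lambda_\theta\}$ (so $W(A) \subseteq P_\theta$), and $z_\theta = x_\theta^* A x_\theta \in L_\theta$, a boundary point of $W(A)$. Given $j$ distinct angles $\theta_1,\ldots,\theta_j$ (modulo $2\pi$) for which the intersection is bounded, $\mathcal{G}_j = \bigcap_{\ell=1}^j P_{\theta_\ell}$ is a convex polygon containing $W(A)$ and $\mathcal{Z}_j = \{z_{\theta_1},\ldots,z_{\theta_j}\}$. Set $l_j = \max\{|b| : b \in \mathcal{Z}_j\}$, $u_j = \max\{|c| : c \text{ a corner of } \mathcal{G}_j\}$, and define the relative error estimate $\varepsilon_j = (u_j - l_j)/l_j$. Uhlig's cutting procedure: one step replaces $\mathcal{G}_i$ by $\mathcal{G}_{i+1} = \mathcal{G}_i \cap P_{\theta_{i+1}}$ and $\mathcal{Z}_i$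 by $\mathcal{Z}_{i+1} = \mathcal{Z}_i \cup \{z_{\theta_{i+1}}\}$, where $\theta_{i+1} = -\operatorname{Arg}(c_i)$ and $c_i$ is an outermost corner (a corner of maximal modulus) of $\mathcal{G}_i$. ''$\mathcal{G}_k$ is a further refined version of $\mathcal{G}_j$'' means that $\mathcal{G}_k$ results from $\mathcal{G}_j$ by $k - j \ge 0$ such successive steps, with $\varepsilon_k = (u_k - l_k)/l_k$, where $l_k = \max\{|b| : b \in \mathcal{Z}_k\}$ and $u_k = \max\{|c| : c \text{ a corner of } \mathcal{G}_k\}$. Here $\operatorname{arcsec}: [1,\infty) \to [0,\pi/2)$. *)

(* Defs.v *)
From mathcomp Require Import all_boot all_order all_algebra.
From mathcomp Require Import complex.
From mathcomp Require Import all_classical all_reals all_analysis.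

Set Implicit Arguments.
Unset Strict Implicit.
Unset Printing Implicit Defensive.

Import Order.TTheory GRing.Theory Num.Theory.
Import numFieldNormedType.Exports.

Local Open Scope classical_set_scope.
Local Open Scope complex_scope.
Local Open Scope sesquilinear_scope.
Local Open Scope ring_scope.

(* Total operator: meaningful only when S has a greatest element. *)
Definition set_max (R : realType) (S : set R) : R :=
  get [set m | S m /\ ubound S m].

Definition cmod (R : realType) (z : R[i]) : R := Normc.normc z.

Definition expi (R : realType) (t : R) : R[i] := cos t +i* sin t.

(* Principal argument; Arg 0 is an unspecified element of ]-pi, pi]. *)
Definition Arg (R : realType) (z : R[i]) : R :=
  get [set t | - pi < t <= pi /\ z = (cmod z)%:C * expi t].

Definition sec (R : realType) (t : R) : R := (cos t)^-1.

(* For 1 <= y, this is the unique t in [0, pi/2[ such that sec t = y. *)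
Definition arcsec (R : realType) (y : R) : R := acos y^-1.

Definition log2 (R : realType) (y : R) : R := ln y / ln 2.

Section FieldOfValues.
Variables (R : realType) (n : nat).
Implicit Types (A : 'M[R[i]]_n) (v : 'cV[R[i]]_n).

Definition vnorm v : R := Num.sqrt (\sum_i cmod (v i 0) ^+ 2).

Definition quadform A v : R[i] := (v ^t* *m A *m v) 0 0.

Definition field_of_values A : set R[i] :=
  [set quadform A v | v in [set v | vnorm v = 1]].

Definition numerical_radius A : R :=
  set_max [set cmod z | z in field_of_values A].

(* The disk is closed because a field of values is compact. *)
Definition disk_matrix A : Prop :=
  exists rho : R, 0 <= rho /\ field_of_values A = [set z | cmod z <= rho].

Definition hermitian_rot A (t : R) : 'M[R[i]]_n :=
  2^-1 *: (expi t *: A + expi (- t) *: A ^t*).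

(* hermitian_rot A t is Hermitian, so its spectrum is real; the library's
   eigenvalue is defined by left eigenvectors, which gives the same spectrum. *)
Definition lambda_max A (t : R) : R :=
  set_max [set l : R | eigenvalue (hermitian_rot A t) l%:C].

Definition top_eigenvector A (t : R) v : Prop :=
  vnorm v = 1 /\ hermitian_rot A t *m v = (lambda_max A t)%:C *: v.

Definition halfplane A (t : R) : set R[i] :=
  [set expi (- t) * z | z in [set z : R[i] | complex.Re z <= lambda_max A t]].

(* In the definitions below th 1, ..., th i are the cutting angles (th 0 is
   not used) and x t is the chosen normalized top eigenvector at angle t. *)

Definition polygon A (th : nat -> R) (i : nat) : set R[i] :=
  \bigcap_(l in [set l | (1 <= l <= i)%N]) halfplane A (th l).

Definition boundary_points A (x : R -> 'cV[R[i]]_n) (th : nat -> R) (i : nat) :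
    set R[i] :=
  [set quadform A (x (th l)) | l in [set l | (1 <= l <= i)%N]].

(* The corners of a convex polygon are its extreme points. *)
Definition corner (G : set R[i]) (c : R[i]) : Prop :=
  G c /\ forall (a b : R[i]) (s : R), G a -> G b -> 0 < s < 1 ->
    c = s%:C * a + (1 - s)%:C * b -> a = c /\ b = c.

Definition outermost_corner (G : set R[i]) (c : R[i]) : Prop :=
  corner G c /\ forall c', corner G c' -> cmod c' <= cmod c.

Definition lower_bound A x (th : nat -> R) (i : nat) : R :=
  set_max [set cmod b | b in boundary_points A x th i].

Definition upper_bound A (th : nat -> R) (i : nat) : R :=
  set_max [set cmod c | c in [set c | corner (polygon A th i) c]].

Definition rel_error A x (th : nat -> R) (i : nat) : R :=
  (upper_bound A th i - lower_bound A x th i) / lower_bound A x th i.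

Definition uhlig_refinement A (th : nat -> R) (j k : nat) : Prop :=
  (j <= k)%N /\
  forall i, (j <= i < k)%N ->
    exists c, outermost_corner (polygon A th i) c /\ th i.+1 = - Arg c.

End FieldOfValues.

(* Main.v *)
(* Writing W(A) as the disk of radius rho, every largest eigenvalue lambda_t is
   rho: rho I - H(t) is positive semidefinite and its form vanishes at a unit
   vector realizing the boundary point rho e^{-it}, which is therefore an
   eigenvector.  So every half plane is tangent to the disk and l_i = rho.

   The regular J-gon has circumradius rho sec(pi/J), attained only at its J
   vertices, and a tangent half plane orthogonal to one vertex removes no other
   vertex.  Hence Uhlig's procedure, started at a regular J-gon, cuts one vertex
   per step and leaves u_i unchanged until all J vertices are gone; at that point
   the polygon is the regular 2J-gon, and the process repeats. *)
Require Import Defs.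
From mathcomp Require Import all_boot all_order all_algebra.
From mathcomp Require Import complex.
From mathcomp Require Import all_classical all_reals all_analysis.
From mathcomp Require Import ring lra zify.

Import Order.TTheory GRing.Theory Num.Theory.

Local Open Scope classical_set_scope.
Local Open Scope complex_scope.
Local Open Scope ring_scope.

(** * Modulus, argument and corners in the complex plane *)

Section Complex.
Context {R : realType}.
Implicit Types (r s t : R) (w z : R[i]).

(** A greatest element is unique, so the choice made by [get] can only return it. *)
Lemma set_maxE (S : set R) (m : R) : S m -> ubound S m -> set_max S = m.
Proof.
move=> Sm ubm; apply: xget_unique => // y [Sy uby].
by apply/eqP; rewrite eq_le ubm // uby.
Qed.

Lemma cmodE z : cmod z = Num.sqrt (complex.Re z ^+ 2 + complex.Im z ^+ 2).
Proof. by case: z. Qed.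

Lemma cmod_ge0 z : 0 <= cmod z.
Proof. by rewrite cmodE sqrtr_ge0. Qed.

Lemma sqr_cmod z : cmod z ^+ 2 = complex.Re z ^+ 2 + complex.Im z ^+ 2.
Proof. by rewrite cmodE sqr_sqrtr // addr_ge0 ?sqr_ge0. Qed.

Lemma cmodM z w : cmod (z * w) = cmod z * cmod w.
Proof. exact: Normc.normcM. Qed.

Lemma cmod_real r : cmod r%:C = `|r|.
Proof. by rewrite cmodE /= expr0n addr0 sqrtr_sqr. Qed.

Lemma Re_le_cmod z : complex.Re z <= cmod z.
Proof.
apply: le_trans (ler_norm _) _; rewrite -sqrtr_sqr cmodE.
by rewrite ler_sqrt ?lerDl ?sqr_ge0 // addr_ge0 ?sqr_ge0.
Qed.

Lemma expi0 : expi 0 = 1 :> R[i].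
Proof. by rewrite /expi cos0 sin0. Qed.

Lemma expiD s t : expi (s + t) = expi s * expi t.
Proof. by rewrite /expi cosD sinD; simpc; congr (_ +i* _); rewrite addrC. Qed.

Lemma expiNK t : expi (- t) * expi t = 1.
Proof. by rewrite -expiD addNr expi0. Qed.

Lemma expiKN t : expi t * expi (- t) = 1.
Proof. by rewrite -expiD addrN expi0. Qed.

Lemma expi_conj t : (expi t)^*%C = expi (- t).
Proof. by rewrite /expi cosN sinN. Qed.

Lemma cmod_expi t : cmod (expi t) = 1.
Proof. by rewrite cmodE /= cos2Dsin2 sqrtr1. Qed.

Lemma Re_expi_polar t r s :
  complex.Re (expi t * (r%:C * expi s)) = r * cos (t + s).
Proof. by rewrite mulrCA -expiD /expi /= mul0r subr0. Qed.

Lemma cosD2pi_int t (a : int) : cos (t + 2 * pi * a%:~R) = cos t.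
Proof.
have cosn n u : cos (u + 2 * pi * n%:R) = cos u :> R.
  rewrite -mulrA mulr_natr mulr2n mulrDl mul1r -mulr2n -mulrnA mulnC mulrnA.
  exact: periodicn (@cosD2pi R) n u.
case: a => n; first exact: cosn.
by rewrite NegzE mulrNz mulrN -[in RHS](subrK (2 * pi * n.+1%:R) t) cosn.
Qed.

Lemma sinD2pi_int t (a : int) : sin (t + 2 * pi * a%:~R) = sin t.
Proof. by rewrite -!cosBpihalf addrAC cosD2pi_int. Qed.

Lemma expiD2pi t (a : int) : expi (t + 2 * pi * a%:~R) = expi t.
Proof. by rewrite /expi cosD2pi_int sinD2pi_int. Qed.

(** [Arg] is a choice, so an admissible angle has to be exhibited: the arccosine of the normalized
    real part, with the sign of the imaginary part. *)
Lemma Arg_polar z : z = (cmod z)%:C * expi (Arg z).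
Proof.
suff [t Pt] : exists t, - pi < t <= pi /\ z = (cmod z)%:C * expi t.
  by rewrite /Arg; case: xgetP => [y _ []//|/(_ t)].
have [z0|zN0] := eqVneq (cmod z) 0.
  exists 0; split; first by rewrite pi_ge0 oppr_lt0 pi_gt0.
  by rewrite z0 mul0r; apply: Normc.eq0_normc.
set x := complex.Re z / cmod z; set y := complex.Im z / cmod z.
have xy1 : x ^+ 2 + y ^+ 2 = 1.
  by rewrite /x /y !expr_div_n -mulrDl -sqr_cmod divff // sqrf_eq0.
have zE : z = (cmod z)%:C * (x +i* y).
  rewrite /x /y; move: (cmod z) zN0 => m mN0; case: z {x y xy1} => a b; simpc.
  by congr (_ +i* _); rewrite /= mulrC divfK.
have x1 : -1 <= x <= 1.
  by rewrite -ler_norml -(ler_pXn2r (n := 2)) ?nnegrE // real_normK ?num_real //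
     expr1n -xy1 lerDl sqr_ge0.
have y2 : Num.sqrt (1 - x ^+ 2) = `|y|.
  by rewrite -xy1 addrC addKr sqrtr_sqr.
have [y0|y0] := leP 0 y.
  exists (acos x); split.
    by rewrite acos_lepi // (lt_le_trans _ (acos_ge0 x1)) // oppr_lt0 pi_gt0.
  by rewrite /expi acosK ?in_itv //= sin_acos // y2 ger0_norm.
exists (- acos x); split; last first.
  by rewrite /expi cosN sinN acosK ?in_itv //= sin_acos // y2 ltr0_norm ?opprK.
rewrite ltrN2 acos_ltpi ?(le_trans _ (pi_ge0 _)) ?oppr_le0 ?acos_ge0 //.
case/andP: x1 => x1 ->; rewrite andbT lt_neqAle x1 andbT.
(* The excluded angle -pi does not occur: x = -1 would force y = 0, whereas y < 0 here. *)
apply/eqP => xN1; move: xy1; rewrite -xN1 sqrrN expr1n => /eqP.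
by rewrite addrC -subr_eq0 addrK sqrf_eq0 lt_eqF.
Qed.

(* By strict convexity of the Euclidean norm. *)
Lemma corner_max_cmod (G : set R[i]) c :
  G c -> (forall w, G w -> cmod w <= cmod c) -> corner G c.
Proof.
move=> Gc maxc; split=> // a b s Ga Gb /andP[s0 s1] cE.
have sqle w : G w -> complex.Re w ^+ 2 + complex.Im w ^+ 2 <=
                complex.Re c ^+ 2 + complex.Im c ^+ 2.
  by move=> Gw; rewrite -!sqr_cmod ler_pXn2r ?nnegrE ?cmod_ge0 // maxc.
have := sqle _ Ga; have := sqle _ Gb.
case: a b c {Gc maxc Ga Gb sqle} cE => [a1 a2] [b1 b2] [c1 c2].
simpc => -[-> ->] /= hb ha.
have h : s * (1 - s) * ((a1 - b1) ^+ 2 + (a2 - b2) ^+ 2) <= 0.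
  have s1' : 0 <= 1 - s by rewrite subr_ge0 ltW.
  by have := ler_wpM2l s1' hb; have := ler_wpM2l (ltW s0) ha; lra.
have {}h : (a1 - b1) ^+ 2 + (a2 - b2) ^+ 2 <= 0.
  by move: h; rewrite pmulr_rle0 // mulr_gt0 // subr_gt0.
have e1 : a1 = b1.
  by apply/eqP; rewrite -subr_eq0 -sqrf_eq0 eq_le sqr_ge0 andbT
    (le_trans _ h) // lerDl sqr_ge0.
have e2 : a2 = b2.
  by apply/eqP; rewrite -subr_eq0 -sqrf_eq0 eq_le sqr_ge0 andbT
    (le_trans _ h) // lerDr sqr_ge0.
by rewrite e1 e2; split; congr (_ +i* _); ring.
Qed.

End Complex.

(** * Cosine at the multiples of pi/J *)

Section Trig.
Context {R : realType}.
Implicit Types (r s t : R).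

(** Cosine decreases on [0, pi]; an [s] beyond pi is first reflected to 2 pi - s. *)
Lemma cos_le_cos t s : 0 <= t <= pi -> t <= s <= 2 * pi - t -> cos s <= cos t.
Proof.
have mono u v : 0 <= u -> v <= pi -> u <= v -> cos v <= cos u :> R.
  move=> u0 vpi uv; rewrite leNgt ltr_cos -?leNgt // in_itv /=.
    by rewrite vpi (le_trans u0).
  by rewrite u0 (le_trans uv).
move=> /andP[t0 tpi] /andP[ts st].
have [spi|/ltW pis] := leP s pi; first exact: mono.
rewrite -[cos s]cosN -(cosD2pi_int _ 1); apply: mono => //; lra.
Qed.

Lemma cos_pi_over_gt0 (J : nat) : (3 <= J)%N -> 0 < cos (pi / J%:R) :> R.
Proof.
move=> J3; apply: cos_gt0_pihalf.
have J0 : 0 < J%:R :> R by rewrite ltr0n (leq_trans _ J3).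
have pi0 := @pi_gt0 R.
have h1 : pi / J%:R < pi / 2 :> R by rewrite ltr_pM2l // ltf_pV2 ?posrE // ltr_nat.
by rewrite h1 andbT (lt_trans _ (divr_gt0 pi0 J0)) // oppr_lt0 divr_gt0.
Qed.

Lemma cos_pi_over_lt1 (J : nat) : (3 <= J)%N -> cos (pi / J%:R) < 1 :> R.
Proof.
move=> J3; have J0 : 0 < J%:R :> R by rewrite ltr0n (leq_trans _ J3).
have pi0 := @pi_gt0 R.
have ? : pi / J%:R <= pi :> R.
  by rewrite ler_pdivrMr // ler_peMr ?pi_ge0 // ler1n (leq_trans _ J3).
rewrite -[X in _ < X]cos0 ltr_cos ?in_itv /= ?lexx ?pi_ge0 ?divr_gt0 //.
by apply/andP; split; first exact/ltW/divr_gt0.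
Qed.

(** The residue of [m] modulo 2J is between 1 and 2J - 1, so up to full turns the angle lies between
    pi/J and 2 pi - pi/J. *)
Lemma cos_mul_pi_over_le (J : nat) (m : int) : (0 < J)%N ->
  ~~ (2 * J%:Z %| m)%Z -> cos (pi / J%:R * m%:~R) <= cos (pi / J%:R) :> R.
Proof.
move=> J0 ndvd.
have J0' : 0 < J%:R :> R by rewrite ltr0n.
have JN0 : J%:R != 0 :> R by rewrite lt0r_neq0.
have mod_ge0 : (0 <= m %% (2 * J%:Z))%Z by rewrite modz_ge0 // mulf_neq0 // eqz_nat -lt0n.
have mod_gt0 : (0 < m %% (2 * J%:Z))%Z.
  by rewrite lt_neqAle mod_ge0 andbT eq_sym; apply: contra ndvd => /eqP/dvdz_mod0P.
have mod_lt : (m %% (2 * J%:Z) < 2 * J%:Z)%Z by rewrite ltz_pmod // mulr_gt0.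
set q := (m %/ (2 * J%:Z))%Z; set p := (m %% (2 * J%:Z))%Z in mod_ge0 mod_gt0 mod_lt.
have -> : pi / J%:R * m%:~R = pi / J%:R * p%:~R + 2 * pi * q%:~R :> R.
  rewrite (divz_eq m (2 * J%:Z)) -/p -/q rmorphD !rmorphM /=; field.
  by rewrite JN0.
rewrite cosD2pi_int; apply: cos_le_cos.
  by rewrite divr_ge0 ?pi_ge0 ?ler0n //= ler_pdivrMr // ler_peMr ?pi_ge0 // ler1n.
have x0 : 0 < pi / J%:R :> R by rewrite divr_gt0 ?pi_gt0.
have -> : 2 * pi - pi / J%:R = pi / J%:R * (2 * J%:R - 1) :> R by field.
rewrite ler_peMr ?(ltW x0) ?ler1z -?gtz0_ge1 //= ler_pM2l //.
have : p%:~R <= (2 * J%:Z - 1)%:~R :> R by rewrite ler_int lerBrDr lezD1.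
by clearbody p; rewrite rmorphB rmorphM.
Qed.

End Trig.

(** * Quadratic forms and Hermitian matrices *)

Section Hermitian.
Context {R : realType} {n : nat}.
Local Open Scope sesquilinear_scope.
Implicit Types (A B H : 'M[R[i]]_n) (v w : 'cV[R[i]]_n).

Lemma ReD (y z : R[i]) : complex.Re (y + z) = complex.Re y + complex.Re z.
Proof. by case: y z => [? ?] []. Qed.

Lemma Re_real_mul (r : R) (z : R[i]) : complex.Re (r%:C * z) = r * complex.Re z.
Proof. by case: z => a b /=; rewrite mul0r subr0. Qed.

Lemma conjC_mul (z : R[i]) : Num.conj z * z = ((cmod z) ^+ 2)%:C.
Proof.
rewrite (_ : Num.conj z = conjc z) // sqr_cmod; case: z => a b; simpc.
by rewrite !expr2 [b * a]mulrC subrr.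
Qed.

Lemma conjC_real (r : R) : Num.conj r%:C = r%:C :> R[i].
Proof. exact: conjc_real. Qed.

Lemma sqr_vnorm v : ((vnorm v) ^+ 2)%:C = (v ^t* *m v) 0 0.
Proof.
rewrite sqr_sqrtr ?sumr_ge0 // => [|i _]; last exact: sqr_ge0.
by rewrite rmorph_sum mxE; apply: eq_bigr => i _; rewrite !mxE conjC_mul.
Qed.

Lemma vnorm_ge0 v : 0 <= vnorm v.
Proof. exact: sqrtr_ge0. Qed.

Lemma vnorm_eq0 v : vnorm v = 0 -> v = 0.
Proof.
move=> /eqP; rewrite sqrtr_eq0 => le0; apply/matrixP => i j; rewrite ord1 mxE.
apply: Normc.eq0_normc; apply/eqP; rewrite -sqrf_eq0 eq_le sqr_ge0 andbT.
by apply: le_trans le0; rewrite (bigD1 i) //= lerDl sumr_ge0 // => k _; rewrite sqr_ge0.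
Qed.

Lemma conjtr_mul m p q (M : 'M[R[i]]_(m, p)) (N : 'M[R[i]]_(p, q)) :
  (M *m N) ^t* = N ^t* *m M ^t*.
Proof. by rewrite trmx_mul map_mxM. Qed.

Lemma conjtrK m p (M : 'M[R[i]]_(m, p)) : M ^t* ^t* = M.
Proof. by apply/matrixP => i j; rewrite !mxE conjCK. Qed.

Lemma quadformZ (c : R[i]) A v :
  quadform A (c *: v) = ((cmod c) ^+ 2)%:C * quadform A v.
Proof.
rewrite /quadform -conjC_mul.
rewrite (_ : (c *: v) ^t* = Num.conj c *: v ^t*); last first.
  by apply/matrixP => i j; rewrite !mxE rmorphM.
by rewrite -!scalemxAl -scalemxAr !mxE mulrA.
Qed.

Lemma quadform_conjtr A v : quadform (A ^t*) v = Num.conj (quadform A v).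
Proof.
have -> : Num.conj (quadform A v) = ((v ^t* *m A *m v) ^t*) 0 0.
  by rewrite [RHS]mxE [in RHS]mxE.
by rewrite !conjtr_mul conjtrK mulmxA.
Qed.

Lemma quadformDmx A B v : quadform (A + B) v = quadform A v + quadform B v.
Proof. by rewrite /quadform mulmxDr mulmxDl mxE. Qed.

Lemma quadformZmx (c : R[i]) A v : quadform (c *: A) v = c * quadform A v.
Proof. by rewrite /quadform -scalemxAr -scalemxAl mxE. Qed.

Lemma quadform_scalar (r : R) v : quadform (r%:C%:M) v = (r * (vnorm v) ^+ 2)%:C.
Proof. by rewrite /quadform mul_mx_scalar -scalemxAl mxE -sqr_vnorm [RHS]rmorphM. Qed.

(** [hermitian_rot A t] is the Hermitian part of e^{it} A, and passing to the Hermitian part takes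
    the real part of the form. *)
Lemma quadform_rot A t v :
  quadform (hermitian_rot A t) v = (complex.Re (expi t * quadform A v))%:C.
Proof.
rewrite /hermitian_rot quadformZmx quadformDmx !quadformZmx quadform_conjtr ReJ_add.
by rewrite mulrC -expi_conj -rmorphM.
Qed.

Lemma hermitian_rot_conjtr A t : (hermitian_rot A t) ^t* = hermitian_rot A t.
Proof.
have eC s : Num.conj (expi s) = expi (- s) :> R[i] by rewrite -expi_conj.
apply/matrixP => i j; rewrite !mxE rmorphM rmorphD !rmorphM fmorphV rmorph_nat.
by rewrite /= !eC conjCK opprK addrC.
Qed.

(* Minimality of the form at v along the line v + s H v, s real. *)
Lemma psd_kernel H v : H ^t* = H ->
  (forall w, 0 <= complex.Re (quadform H w)) -> quadform H v = 0 -> H *m v = 0.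
Proof.
move=> Hherm Hpsd qv0; apply: vnorm_eq0; set w := H *m v.
have wE : w ^t* = v ^t* *m H by rewrite /w conjtr_mul Hherm.
have line s : 0 <= 2 * s * (vnorm w) ^+ 2 + s ^+ 2 * complex.Re (quadform H w).
  have -> : 2 * s * (vnorm w) ^+ 2 + s ^+ 2 * complex.Re (quadform H w) =
      complex.Re (quadform H (v + s%:C *: w)); last exact: Hpsd.
  have -> : quadform H (v + s%:C *: w) =
      (2 * s * (vnorm w) ^+ 2)%:C + (s ^+ 2)%:C * quadform H w.
    rewrite /quadform in qv0 *.
    rewrite (_ : (v + s%:C *: w) ^t* = v ^t* + s%:C *: w ^t*); last first.
      by apply/matrixP => i j; rewrite !mxE rmorphD rmorphM /= conjC_real.
    rewrite !(mulmxDr, mulmxDl) -!(scalemxAr, scalemxAl) -wE -[_ *m H *m v]mulmxA -/w.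
    have coefD (M N : 'M[R[i]]_1) : (M + N) 0 0 = M 0 0 + N 0 0 by rewrite mxE.
    have coefZ c (M : 'M[R[i]]_1) : (c *: M) 0 0 = c * M 0 0 by rewrite mxE.
    rewrite -wE in qv0; rewrite !(coefD, coefZ) qv0.
    rewrite [(2 * s * _)%:C]rmorphM /= [(2 * s)%:C]rmorphM.
    rewrite [(s ^+ 2)%:C]rmorphXn /= sqr_vnorm rmorph_nat; ring.
  by rewrite ReD Re_real_mul.
have q0 := Hpsd w; move: (complex.Re _) q0 line => q q0 line.
apply/eqP; rewrite -sqrf_eq0; move: (vnorm w ^+ 2) (sqr_ge0 (vnorm w)) line => N N0 line.
rewrite eq_le N0 andbT leNgt; apply/negP => {}N0.
(* If N > 0, the term linear in s wins for small negative s. The value s = -N / (q + 1) is safe also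
   when q = 0: with u = N / (q + 1) the expression becomes -u^2 (q + 2) < 0. *)
have d0 : 0 < q + 1 by lra.
have u0 : 0 < N / (q + 1) by rewrite divr_gt0.
have := line (- (N / (q + 1))); have : N = N / (q + 1) * (q + 1) by rewrite divfK ?gt_eqF.
move: (N / (q + 1)) u0 => u u0 NE; rewrite [in X in _ <= X]NE.
have -> : 2 * - u * (u * (q + 1)) + (- u) ^+ 2 * q = - (u ^+ 2 * (q + 2)) by ring.
by rewrite oppr_ge0 leNgt mulr_gt0 // ?exprn_gt0 //; lra.
Qed.

End Hermitian.

(** The boundary line touches the circle of radius [rho] at rho e^{-it}, whose argument is -t; hence
    the minus signs in the angles below. *)
Definition tangent_halfplane {R : realType} (rho t : R) : set R[i] :=
  [set w | complex.Re (expi t * w) <= rho].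

(** * Eigenvalues and boundary points of a disk matrix *)

Section DiskMatrix.
Context {R : realType} {n : nat}.
Variables (A : 'M[R[i]]_n) (rho : R).
Local Open Scope sesquilinear_scope.
Hypothesis rho_ge0 : 0 <= rho.
Hypothesis W_disk : field_of_values A = [set z | cmod z <= rho].
Implicit Types (t : R) (v : 'cV[R[i]]_n).

Lemma numerical_radius_disk : numerical_radius A = rho.
Proof.
apply: set_maxE; last by move=> _ [z + <-]; rewrite W_disk.
have cmod_rho : cmod rho%:C = rho by rewrite cmod_real ger0_norm.
by exists rho%:C; rewrite // W_disk /mkset cmod_rho.
Qed.

(** Both sides scale with the squared norm of [v], which reduces the bound to unit vectors, where
    the form takes its values in the disk. *)
Lemma Re_quadform_le t v :
  complex.Re (expi t * quadform A v) <= rho * (vnorm v) ^+ 2.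
Proof.
have [v0|vN0] := eqVneq (vnorm v) 0.
  by rewrite v0 expr0n mulr0 (vnorm_eq0 _ v0) /quadform mulmx0 mxE mulr0.
pose u := ((vnorm v)^-1)%:C *: v.
have vE : v = (vnorm v)%:C *: u by rewrite /u scalerA -rmorphM divff // scale1r.
have u1 : vnorm u = 1.
  apply/eqP; rewrite -(@eqrXn2 _ 2) ?vnorm_ge0 // expr1n; apply/eqP/complexI.
  (* The form of the identity matrix is the squared norm, so [quadformZ] also computes the norm of
     u. *)
  have := quadformZ (vnorm v)^-1%:C 1%:M v; rewrite -/u.
  rewrite -(rmorph1 (real_complex R)) !quadform_scalar !mul1r => ->.
  rewrite cmod_real ger0_norm ?invr_ge0 ?vnorm_ge0 // -rmorphM.
  by rewrite -exprMn mulVf // expr1n.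
have : field_of_values A (quadform A u) by exists u.
rewrite W_disk /= => qu.
rewrite vE quadformZ -vE mulrCA Re_real_mul mulrC cmod_real ger0_norm ?vnorm_ge0 //.
apply: ler_wpM2r; first exact: sqr_ge0.
by rewrite (le_trans (Re_le_cmod _)) // cmodM cmod_expi mul1r.
Qed.

Lemma lambda_max_disk t : lambda_max A t = rho.
Proof.
apply: set_maxE => [|l /eigenvalueP[u uE uN0]].
  have [v v1 qv] : field_of_values A (rho%:C * expi (- t)).
    by rewrite W_disk /mkset cmodM cmod_expi mulr1 cmod_real ger0_norm.
  have Hv : (rho%:C%:M - hermitian_rot A t) *m v = 0.
    apply: psd_kernel => [|w|].
    - rewrite linearB /= map_mxB hermitian_rot_conjtr; congr (_ - _).
      apply/matrixP => i j; rewrite !mxE eq_sym raddfMn.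
      by rewrite /= conjC_real.
    - rewrite -scaleN1r quadformDmx quadformZmx mulN1r quadform_rot quadform_scalar.
      by rewrite -rmorphB /= subr_ge0 Re_quadform_le.
    - rewrite -scaleN1r quadformDmx quadformZmx mulN1r quadform_rot quadform_scalar.
      by rewrite v1 qv Re_expi_polar subrr cos0 expr1n subrr.
  have {}Hv : hermitian_rot A t *m v = rho%:C *: v.
    by apply/esym/eqP; rewrite -subr_eq0 -mul_scalar_mx -mulmxBl Hv.
  (* [eigenvalue] asks for a left eigenvector; the adjoint of v is one because the matrix is
     Hermitian and [rho] is real. *)
  apply/eigenvalueP; exists (v ^t*).
    rewrite -{1}hermitian_rot_conjtr -conjtr_mul Hv.
    by apply/matrixP => i j; rewrite !mxE rmorphM /= conjC_real.
  apply/eqP => v0; move: v1; rewrite -(conjtrK _ _ v) v0 /=.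
  rewrite /vnorm big1 ?sqrtr0 => [/esym/eqP|i _]; first by rewrite oner_eq0.
  by rewrite !mxE rmorph0 cmod_real normr0 expr0n.
(* For maximality, the form at the adjoint of a left eigenvector u equals l times its squared norm,
   to which [Re_quadform_le] applies. *)
have wN0 : vnorm (u ^t*) != 0.
  apply: contraNneq uN0 => /vnorm_eq0 w0.
  by rewrite -(conjtrK _ _ u) w0; apply/eqP/matrixP => i j; rewrite !mxE rmorph0.
have : quadform (hermitian_rot A t) (u ^t*) = (l * vnorm (u ^t*) ^+ 2)%:C.
  by rewrite /quadform conjtrK uE -scalemxAl mxE [RHS]rmorphM /= sqr_vnorm conjtrK.
rewrite quadform_rot => /complexI qE.
by have := Re_quadform_le t (u ^t*); rewrite qE ler_pM2r // exprn_gt0 // lt0r wN0 vnorm_ge0.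
Qed.

Lemma halfplane_disk t :
  halfplane A t = tangent_halfplane rho t.
Proof.
rewrite /tangent_halfplane; apply/seteqP; split=> [_ [z + <-]|w] /=.
  by rewrite lambda_max_disk mulrA expiKN mul1r.
by exists (expi t * w); rewrite /= ?lambda_max_disk // mulrA expiNK mul1r.
Qed.

(** The disk bounds the modulus above by [rho]. Below, the eigenvector equation gives Re (e^{it} z)
    = rho, and a modulus dominates the real part. *)
Lemma boundary_point_cmod t v :
  top_eigenvector A t v -> cmod (quadform A v) = rho.
Proof.
move=> [v1 vE].
have : field_of_values A (quadform A v) by exists v.
rewrite W_disk /= => qle; apply/eqP; rewrite eq_le qle /=.
have : quadform (hermitian_rot A t) v = rho%:C.
  rewrite /quadform -mulmxA vE lambda_max_disk -scalemxAr mxE -sqr_vnorm v1.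
  by rewrite expr1n mulr1.
rewrite quadform_rot => /complexI <-.
by rewrite (le_trans (Re_le_cmod _)) // cmodM cmod_expi mul1r.
Qed.

Lemma lower_bound_disk (x : R -> 'cV[R[i]]_n) (th : nat -> R) (i : nat) :
  (forall t, top_eigenvector A t (x t)) -> (0 < i)%N ->
  lower_bound A x th i = rho.
Proof.
move=> xP i0; apply: set_maxE; last first.
  by move=> _ [_ [l _ <-] <-]; rewrite (boundary_point_cmod _ _ (xP _)).
exists (quadform A (x (th 1%N))); first by exists 1%N.
exact: boundary_point_cmod (xP _).
Qed.

Lemma field_of_values_sub_polygon (th : nat -> R) (i : nat) :
  field_of_values A `<=` polygon A th i.
Proof.
move=> z; rewrite W_disk => /= zle l _; rewrite halfplane_disk.
by rewrite /tangent_halfplane /mkset (le_trans (Re_le_cmod _)) // cmodM cmod_expi mul1r.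
Qed.

End DiskMatrix.

(** * Vertex indices modulo J *)

Lemma int_mod_ord (J : nat) (b : int) : (0 < J)%N ->
  exists (a : 'I_J) (q : int), b = (a : nat)%:Z + J%:Z * q.
Proof.
move=> J0; have J0z : 0 < J%:Z by [].
have JN0 : J%:Z != 0 by rewrite gt_eqF.
have r0 := modz_ge0 b JN0; have rJ := ltz_pmod b J0z.
have aJ : (`|(b %% J)%Z| < J)%N by lia.
exists (Ordinal aJ), (b %/ J)%Z; rewrite /= gez0_abs // addrC mulrC.
exact: divz_eq.
Qed.

Lemma exists_notin (T : finType) (S : {set T}) :
  S != [set: T]%SET -> exists a, a \notin S.
Proof.
move=> SN; apply/existsP; rewrite -negb_forall.
by apply: contra SN => /forallP ST; apply/eqP/setP => a; rewrite inE ST.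
Qed.

(** Parity; this will place every vertex in all half planes of the regular polygon. *)
Lemma ndvd_odd (J : nat) (m : int) : ~~ (2 * J%:Z %| 2 * m + 1)%Z.
Proof. by apply/negP => /dvdzP[q]; lia. Qed.

(** Two indices below J differ by less than J. This will place a vertex in the cuts made at the
    other vertices. *)
Lemma ndvd_ord_sub (J : nat) (a b : 'I_J) : a != b ->
  ~~ (2 * J%:Z %| 2 * ((a : nat)%:Z - (b : nat)%:Z))%Z.
Proof.
apply: contra => /dvdzP[q qE]; apply/eqP/val_inj => /=.
have := ltn_ord a; have := ltn_ord b.
have : (a : nat)%:Z - (b : nat)%:Z = q * J by lia.
have [|[->|]] : q <= -1 \/ q = 0 \/ 1 <= q by lia.
all: nia.
Qed.

(** * Regular polygons with some vertices cut off *)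

Section CutPolygon.
Context {R : realType}.
Variable rho : R.
Hypothesis rho_gt0 : 0 < rho.
Implicit Types (w c : R[i]) (t : R).

(* The angles at even multiples of pi/J give the regular J-gon; the angle at the
   odd multiple 2a+1 is orthogonal to its a-th vertex, and S is the set of the
   vertices already cut off. *)
Definition cut_polygon (J : nat) (S : {set 'I_J}) : set R[i] :=
  [set w | (forall a : int, tangent_halfplane rho (pi / J%:R * (2 * a)%:~R) w) /\
    forall a : 'I_J, a \in S ->
      tangent_halfplane rho (pi / J%:R * (2 * (a : nat)%:Z + 1)%:~R) w].

(** The sides touching the circle at arguments -2a pi/J and -(2a+2) pi/J meet on their bisector, at
    distance rho / cos (pi/J) from 0. *)
Definition vertex (J : nat) (a : 'I_J) : R[i] :=
  (rho / cos (pi / J%:R))%:C * expi (- (pi / J%:R * (2 * (a : nat)%:Z + 1)%:~R)).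

Lemma tangent_halfplaneD2pi t (a : int) :
  tangent_halfplane rho (t + 2 * pi * a%:~R) = tangent_halfplane rho t.
Proof. by rewrite /tangent_halfplane expiD2pi. Qed.

Lemma tangent_halfplane_modJ (J : nat) (a q : int) : (0 < J)%N ->
  tangent_halfplane rho (pi / J%:R * (a + 2 * J%:Z * q)%:~R) =
  tangent_halfplane rho (pi / J%:R * a%:~R).
Proof.
move=> J0; rewrite -[RHS](tangent_halfplaneD2pi _ q); congr (tangent_halfplane rho _).
have JN0 : J%:R != 0 :> R by rewrite pnatr_eq0 -lt0n.
by rewrite rmorphD !rmorphM /=; field.
Qed.

Section Gon.
Variable J : nat.
Hypothesis J3 : (3 <= J)%N.
Let J0 : (0 < J)%N. Proof. exact: leq_trans J3. Qed.
Implicit Types (a b : 'I_J) (S : {set 'I_J}).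

Lemma circumradius_gt0 : 0 < rho / cos (pi / J%:R).
Proof. by rewrite divr_gt0 ?cos_pi_over_gt0. Qed.

Lemma cmod_vertex a : cmod (vertex J a) = rho / cos (pi / J%:R).
Proof. by rewrite cmodM cmod_expi mulr1 cmod_real gtr0_norm ?circumradius_gt0. Qed.

(** The real part to be bounded is the circumradius times cos ((m - 2a - 1) pi/J), so it is at most
    [rho] once this cosine is at most cos (pi/J). *)
Lemma vertex_tangent_halfplane a (m : int) :
  ~~ (2 * J%:Z %| m - (2 * (a : nat)%:Z + 1))%Z ->
  tangent_halfplane rho (pi / J%:R * m%:~R) (vertex J a).
Proof.
move=> ndvd; rewrite /tangent_halfplane /mkset Re_expi_polar -mulrBr -rmorphB /=.
rewrite -mulrA ger_pMr // mulrC ler_pdivrMr ?cos_pi_over_gt0 // mul1r.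
exact: cos_mul_pi_over_le.
Qed.

Lemma cut_polygon_vertex S a : a \notin S -> cut_polygon J S (vertex J a).
Proof.
move=> aS; split=> [b|b bS]; apply: vertex_tangent_halfplane.
  by rewrite (_ : _ - _ = 2 * (b - (a : nat)%:Z - 1) + 1) ?ndvd_odd //; lia.
rewrite (_ : _ - _ = 2 * ((b : nat)%:Z - (a : nat)%:Z)); last by lia.
by apply: ndvd_ord_sub; apply: contraNneq aS => <-.
Qed.

(** The nearest normal of the J-gon is at an angle e <= pi/J from [w], and its half plane gives |w|
    cos e <= rho. The bound on |w| is attained only for e = pi/J, that is, in the direction of a
    vertex. *)
Lemma cut_polygon_cmod S w : cut_polygon J S w ->
  cmod w < rho / cos (pi / J%:R) \/
  cmod w = rho / cos (pi / J%:R) /\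
    exists b : int, - Arg w = pi / J%:R * (2 * b + 1)%:~R.
Proof.
move=> [base _]; have J0R : 0 < J%:R :> R by rewrite ltr0n.
set h := pi / J%:R in base *; have h0 : 0 < h by rewrite divr_gt0 ?pi_gt0.
have hpi : h <= pi by rewrite ler_pdivrMr // ler_peMr ?pi_ge0 // ler1n.
have ch0 : 0 < cos h by rewrite cos_pi_over_gt0.
pose phi := Arg w; pose y := - phi / (2 * h); pose b := Num.floor y.
have /andP[by1 by2] := floor_itv y; rewrite -/b in by1 by2.
have h20 : 0 < 2 * h by lra.
rewrite ler_pdivlMr // in by1; rewrite intrD1 ltr_pdivrMr // in by2.
(* Here e is the distance from -phi to the nearer of 2bh and 2(b+1)h. A tie goes to the first, so e
   = h occurs only in that branch. *)
have [e [e0 eh cose ecase]] : exists e, [/\ 0 <= e, e <= h,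
    cmod w * cos e <= rho & e = h -> - phi = h * (2 * b + 1)%:~R].
  have bE : (2 * b + 1)%:~R = 2 * b%:~R + 1 :> R by rewrite rmorphD rmorphM.
  rewrite bE; have [d0|d0] := leP (- phi) (h * (2 * b%:~R + 1)).
    exists (- phi - b%:~R * (2 * h)); split; [lra|lra| |lra].
    have := base b; rewrite /tangent_halfplane /mkset {1}[w]Arg_polar Re_expi_polar -/phi.
    by rewrite -cosN rmorphM /= (_ : - (_ + _) = - phi - b%:~R * (2 * h)) //; ring.
  exists (phi + (b%:~R + 1) * (2 * h)); split; [lra|lra| |lra].
  have := base (b + 1); rewrite /tangent_halfplane /mkset {1}[w]Arg_polar Re_expi_polar -/phi.
  by rewrite rmorphM rmorphD /= (_ : _ + phi = phi + (b%:~R + 1) * (2 * h)) //; ring.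
have [eN|eE] := eqVneq e h; last first.
  (* The point 0 is set apart because strictness survives multiplication by |w| only if |w| > 0. *)
  left; have [->|wN0] := eqVneq (cmod w) 0; first exact: circumradius_gt0.
  rewrite ltr_pdivlMr // (lt_le_trans _ cose) // ltr_pM2l; last first.
    by rewrite lt0r wN0 cmod_ge0.
  by rewrite ltr_cos ?in_itv /= ?e0 ?(ltW h0) ?(le_trans eh) // lt_neqAle eE.
have := cose; rewrite eN -ler_pdivlMr // le_eqVlt => /orP[/eqP wE|]; last by left.
by right; split=> //; exists b; apply: ecase.
Qed.

Lemma cut_polygon_cmod_le S w :
  cut_polygon J S w -> cmod w <= rho / cos (pi / J%:R).
Proof. by case/cut_polygon_cmod => [/ltW|[->]]. Qed.

Lemma corner_vertex S a : a \notin S -> corner (cut_polygon J S) (vertex J a).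
Proof.
move=> aS; apply: corner_max_cmod; first exact: cut_polygon_vertex.
by move=> w /cut_polygon_cmod_le; rewrite cmod_vertex.
Qed.

(** A surviving vertex forces the modulus of [c] to be the circumradius, so [c] points towards some
    vertex a and the new half plane is the cut at a. *)
Lemma cut_outermost_corner S c : S != [set: 'I_J]%SET ->
  outermost_corner (cut_polygon J S) c ->
  exists2 a, a \notin S &
    cut_polygon J S `&` tangent_halfplane rho (- Arg c) = cut_polygon J (a |: S)%SET.
Proof.
move=> SN [[Sc _] cmax].
have [a0 a0S] := exists_notin _ _ SN.
have [clt|[cE [b argE]]] := cut_polygon_cmod _ _ Sc.
  by have := cmax _ (corner_vertex _ _ a0S); rewrite cmod_vertex leNgt clt.
have [a [q bE]] := int_mod_ord J b J0.
have cutE : tangent_halfplane rho (- Arg c) =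
    tangent_halfplane rho (pi / J%:R * (2 * (a : nat)%:Z + 1)%:~R).
  rewrite argE (_ : 2 * b + 1 = 2 * (a : nat)%:Z + 1 + 2 * J%:Z * q); last by lia.
  exact: tangent_halfplane_modJ.
exists a.
  (* Had a been cut before, [c] would satisfy that cut, giving |c| <= rho; but the circumradius
     exceeds [rho]. *)
  apply/negP => aS; have := Sc.2 _ aS; rewrite -cutE /tangent_halfplane /mkset.
  rewrite {2}[c]Arg_polar Re_expi_polar addNr cos0 mulr1 cE ler_pdivrMr ?cos_pi_over_gt0 //.
  by rewrite ler_pMr // leNgt cos_pi_over_lt1.
rewrite cutE; apply/seteqP; split=> w.
  move=> [[base cut] wa]; split=> // b'; rewrite !inE => /orP[/eqP->//|].
  exact: cut.
move=> [base cut]; split; last by apply: cut; rewrite !inE eqxx.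
by split=> // b' b'S; apply: cut; rewrite !inE b'S orbT.
Qed.

(** In units of pi/J, the even multiples are the old sides and the odd ones the cuts; together they
    are the sides of the 2J-gon. The equation on [J'] lets the lemma apply to [j * 2 ^ m.+1] without
    casting the finite type. *)
Lemma cut_polygon_full (J' : nat) : J' = (2 * J)%N ->
  cut_polygon J [set: 'I_J]%SET = cut_polygon J' (finset.set0 : {set 'I_J'}).
Proof.
move=> ->; have angleE (m : int) : pi / (2 * J)%:R * (2 * m)%:~R = pi / J%:R * m%:~R :> R.
  have JN0 : J%:R != 0 :> R by rewrite pnatr_eq0 -lt0n.
  by rewrite natrM rmorphM /=; field.
apply/seteqP; split=> w [base cut]; split=> [m|a]; last 2 first.
- by rewrite -angleE; apply: base.
- by move=> _; rewrite -angleE; apply: base.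
- rewrite angleE; have [b [mE|mE]] : exists b : int, m = 2 * b \/ m = 2 * b + 1.
    by exists (m %/ 2)%Z; lia.
  - by rewrite mE; apply: base.
  have [a [q bE]] := int_mod_ord J b J0.
  have -> : m = 2 * (a : nat)%:Z + 1 + 2 * J%:Z * q by lia.
  by rewrite tangent_halfplane_modJ //; apply: cut; rewrite inE.
- by rewrite inE.
Qed.

End Gon.
End CutPolygon.

(** * Uhlig's procedure started at the regular polygon *)

Section Refinement.
Context {R : realType} {n : nat}.
Variables (A : 'M[R[i]]_n) (rho : R).
Hypothesis rho_gt0 : 0 < rho.
Hypothesis W_disk : field_of_values A = [set z | cmod z <= rho].
Variables (j : nat) (th : nat -> R).
Hypothesis j3 : (3 <= j)%N.
Hypothesis th_reg : forall l, (1 <= l <= j)%N -> th l = 2 * pi / j%:R * l%:R.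

Lemma polygonS i :
  polygon A th i.+1 = polygon A th i `&` tangent_halfplane rho (th i.+1).
Proof.
rewrite -(halfplane_disk _ _ (ltW rho_gt0) W_disk).
apply/seteqP; split=> w.
  move=> Gw; split=> [l /= /andP[l1 li]|]; apply: Gw => /=.
    by rewrite l1 ltnW.
  by rewrite leqnn.
move=> [Gw thw] l /= /andP[l1]; rewrite leq_eqVlt => /orP[/eqP->//|li].
by apply: Gw; rewrite /= l1.
Qed.

Lemma polygon_sub i k : (i <= k)%N -> polygon A th k `<=` polygon A th i.
Proof.
move=> ik w Gw l /= /andP[l1 li]; apply: Gw.
by rewrite /= l1 (leq_trans li).
Qed.

Lemma polygon_regular :
  polygon A th j = cut_polygon rho j (finset.set0 : {set 'I_j}).
Proof.
have j0 : (0 < j)%N by exact: leq_trans j3.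
have angleE l : (1 <= l <= j)%N ->
    halfplane A (th l) = tangent_halfplane rho (pi / j%:R * (2 * l%:Z)%:~R).
  move=> lj; rewrite (halfplane_disk _ _ (ltW rho_gt0) W_disk) th_reg //.
  congr (tangent_halfplane rho _); rewrite rmorphM /=; ring.
apply/seteqP; split=> w.
  move=> Gw; split=> [m|a]; last by rewrite inE.
  (* The cutting angles are numbered from 1 to j, so m - 1 is reduced and the representative of m is
     a + 1. *)
  have [a [q mE]] := int_mod_ord j (m - 1) j0.
  have aj : (1 <= a.+1 <= j)%N by rewrite /= ltn_ord.
  rewrite (_ : 2 * m = 2 * a.+1%:Z + 2 * j%:Z * q); last by lia.
  by rewrite tangent_halfplane_modJ // -angleE //; apply: Gw.
by move=> [base _] l /= lj; rewrite angleE.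
Qed.

Lemma upper_bound_cut J (S : {set 'I_J}) i : (3 <= J)%N ->
  S != [set: 'I_J]%SET -> polygon A th i = cut_polygon rho J S ->
  upper_bound A th i = rho / cos (pi / J%:R).
Proof.
move=> J3 SN GE; rewrite /upper_bound GE; apply: set_maxE; last first.
  by move=> _ [c [/(cut_polygon_cmod_le _ rho_gt0 _ J3)]] + _ <-.
have [a aS] := exists_notin _ _ SN.
by exists (vertex rho J a); [exact: corner_vertex|exact: cmod_vertex].
Qed.

(** Induction on the number of half planes. Keeping [S] proper leaves an uncut vertex for the next
    step; a completed round is recorded as the next [m] with [S] empty. *)
Lemma refinement_cut_polygon k : uhlig_refinement A th j k ->
  exists (m : nat) (S : {set 'I_(j * 2 ^ m)}),
    [/\ S != [set: _]%SET, (j * 2 ^ m + #|S| = k)%N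
      & polygon A th k = cut_polygon rho (j * 2 ^ m) S].
Proof.
have J3 m : (3 <= j * 2 ^ m)%N by rewrite (leq_trans j3) // leq_pmulr // expn_gt0.
have set0N m : (finset.set0 : {set 'I_(j * 2 ^ m)}) != [set: _]%SET.
  apply/eqP => /setP/(_ (Ordinal (leq_trans (isT : 0 < 3)%N (J3 m)))).
  by rewrite !inE.
elim: k => [|k IHk] [jk step].
  by have := leq_trans j3 jk.
move: jk; rewrite leq_eqVlt => /orP[/eqP jE|jk].
  exists 0%N, finset.set0; split=> //; first by rewrite cards0 muln1 addn0.
  (* The index type changes from ['I_j] to ['I_(j * 2 ^ 0)], so the equation j = j * 1 is eliminated
     by dependent case analysis. *)
  by rewrite -jE polygon_regular; move: (esym (muln1 j)); case: _ /.
have [|m [S [SN cardS GE]]] := IHk.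
  by split=> // i /andP[ji ik]; apply: step; rewrite ji ltnW.
have /step[c [cmax thE]] : (j <= k < k.+1)%N by rewrite -ltnS jk ltnSn.
rewrite GE in cmax; have [a aS cutE] := cut_outermost_corner _ rho_gt0 _ (J3 m) _ _ SN cmax.
have GE' : polygon A th k.+1 = cut_polygon rho (j * 2 ^ m) (a |: S)%SET.
  by rewrite polygonS GE thE cutE.
have cardS' : (j * 2 ^ m + #|a |: S|%SET = k.+1)%N.
  by rewrite cardsU1 aS -cardS addnCA.
have [SE|SN'] := eqVneq (a |: S)%SET [set: _]%SET; last by exists m, (a |: S)%SET.
exists m.+1, finset.set0; split=> //.
  by rewrite cards0 -cardS' SE cardsT card_ord expnS; lia.
rewrite GE' SE; apply: cut_polygon_full => //.
by rewrite expnS mulnCA.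
Qed.

(** One surviving vertex fixes the upper bound at the circumradius, so the error depends on [J]
    alone and stays constant during a round. *)
Lemma rel_error_cut (x : R -> 'cV[R[i]]_n) J (S : {set 'I_J}) i :
  (forall t, top_eigenvector A t (x t)) -> (0 < i)%N -> (3 <= J)%N ->
  S != [set: 'I_J]%SET -> polygon A th i = cut_polygon rho J S ->
  rel_error A x th i = sec (pi / J%:R) - 1.
Proof.
move=> xP i0 J3 SN GE; rewrite /rel_error (upper_bound_cut _ _ _ J3 SN GE).
rewrite (lower_bound_disk _ _ (ltW rho_gt0) W_disk) //.
have rhoN0 : rho != 0 by rewrite gt_eqF.
by rewrite /sec mulrBl divff // mulrAC divff // mul1r.
Qed.

End Refinement.

(** * From the tolerance to an angle *)

Section Arcsec.
Context {R : realType}.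
Variable tau : R.
Hypothesis tau_gt0 : 0 < tau.

Let inv_bounds : 0 < (1 + tau)^-1 < 1.
Proof. by rewrite invr_gt0 invf_lt1 ?ltrDl ?addr_gt0 ?tau_gt0. Qed.

Lemma arcsec_gt0 : 0 < arcsec (1 + tau).
Proof. by case/andP: inv_bounds => h0 h1; rewrite acos_gt0 // h1 andbT; lra. Qed.

(** Inverting turns the bound on the secant into cos (pi/J) >= 1 / (1 + tau), and cosine is
    decreasing on [0, pi]. *)
Lemma le_arcsec (J : nat) : (3 <= J)%N ->
  sec (pi / J%:R) - 1 <= tau -> pi / J%:R <= arcsec (1 + tau).
Proof.
move=> J3; rewrite lerBlDl => sec_le.
have J0 : 0 < J%:R :> R by rewrite ltr0n (leq_trans _ J3).
have [h0 h1] := andP inv_bounds; have c0 := @cos_pi_over_gt0 R J J3.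
have cosle : (1 + tau)^-1 <= cos (pi / J%:R).
  by rewrite -[leRHS]invrK lef_pV2 // posrE ?invr_gt0 // addr_gt0.
have pi0 := @pi_gt0 R.
have bnd : -1 <= (1 + tau)^-1 <= 1 by lra.
have hpi : pi / J%:R <= pi :> R.
  by rewrite ler_pdivrMr // ler_peMr ?pi_ge0 // ler1n (leq_trans _ J3).
rewrite leNgt -ltr_cos ?in_itv /= ?acos_ge0 ?acos_lepi //.
  by rewrite acosK ?in_itv //= -leNgt.
by rewrite hpi andbT divr_ge0 // ltW.
Qed.

End Arcsec.

Theorem theorem4p1 (R : realType) (n : nat) (A : 'M[R[i]]_n)
    (x : R -> 'cV[R[i]]_n) (j : nat) (th : nat -> R) (tau : R) :
  disk_matrix A ->
  0 < numerical_radius A ->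
  (forall t : R, top_eigenvector A t (x t)) ->
  (3 <= j)%N ->
  (forall l : nat, (1 <= l <= j)%N -> th l = 2 * pi / j%:R * l%:R) ->
  0 < tau ->
  [/\ rel_error A x th j = sec (pi / j%:R) - 1,
      rel_error A x th j <= tau ->
        Num.ceil (pi / arcsec (1 + tau)) <= j%:Z
    & forall k : nat, uhlig_refinement A th j k ->
      [/\ field_of_values A `<=` polygon A th k /\
            polygon A th k `<=` polygon A th j,
          rel_error A x th k < rel_error A x th j -> (2 * j <= k)%N
        & rel_error A x th k <= tau -> tau < rel_error A x th j ->
          j%:R * (2 : R) ^ Num.ceil (log2 (pi / (j%:R * arcsec (1 + tau))))
            <= k%:R]].
Proof.
move=> [rho [rho_ge0 W_disk]]; rewrite (numerical_radius_disk _ _ rho_ge0 W_disk).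
move=> rho_gt0 xP j3 th_reg tau_gt0.
have j0 : (0 < j)%N by exact: leq_trans j3.
have j0R : 0 < j%:R :> R by rewrite ltr0n.
have a0 := arcsec_gt0 _ tau_gt0.
have set0N : (finset.set0 : {set 'I_j}) != [set: _]%SET.
  by apply/eqP => /setP/(_ (Ordinal j0)); rewrite !inE.
have errj : rel_error A x th j = sec (pi / j%:R) - 1.
  apply: (rel_error_cut _ _ rho_gt0 W_disk) set0N _ => //.
  exact: polygon_regular W_disk _ _ j3 th_reg.
split=> // [|k ref].
  rewrite errj => /(le_arcsec _ tau_gt0 _ j3) le_a.
  by rewrite ceil_le_int ler_pdivrMr // mulrC -ler_pdivrMr.
have [m [S [SN kE GE]]] := refinement_cut_polygon _ _ rho_gt0 W_disk _ _ j3 th_reg _ ref.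
have J3 : (3 <= j * 2 ^ m)%N by rewrite (leq_trans j3) // leq_pmulr // expn_gt0.
have jk := ref.1.
have errk : rel_error A x th k = sec (pi / (j * 2 ^ m)%:R) - 1.
  apply: (rel_error_cut _ _ rho_gt0 W_disk) SN GE => //.
  exact: leq_trans j0 jk.
split.
- split; first exact: field_of_values_sub_polygon W_disk _ _.
  exact: polygon_sub.
(* With m = 0 both errors are equal, against strictness; with m >= 1, k is at least j 2^m >= 2j. *)
- rewrite errj errk; case: m S SN kE {GE J3 errk} => [|m] S _ kE.
    by rewrite muln1 ltxx.
  move=> _; rewrite -kE (leq_trans _ (leq_addr _ _)) // mulnC leq_pmul2l //.
  by rewrite expnS leq_pmulr // expn_gt0.
rewrite errk => /(le_arcsec _ tau_gt0 _ J3) le_a _.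
have p2 : 0 < 2 ^+ m :> R by rewrite exprn_gt0.
(* The angle bound reads pi / (j arcsec (1 + tau)) <= 2^m; since m is an integer, the logarithm may
   be rounded up. *)
have ceil_le : Num.ceil (log2 (pi / (j%:R * arcsec (1 + tau)))) <= m%:Z.
  rewrite ceil_le_int /log2 ler_pdivrMr ?ln_gt0 ?ltr1n //.
  rewrite -[m%:~R]/(m%:R) [X in _ <= X]mulr_natl -lnXn //.
  rewrite ler_ln ?posrE ?divr_gt0 ?mulr_gt0 ?pi_gt0 //.
  move: le_a; rewrite natrM natrX !ler_pdivrMr ?mulr_gt0 //.
  by rewrite [arcsec _ * _]mulrC -mulrA mulrCA.
have two_le : (2 : R) ^ Num.ceil (log2 (pi / (j%:R * arcsec (1 + tau)))) <= 2 ^+ m.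
  by rewrite exprnP; apply: ler_weXz2l ceil_le; rewrite ler1n.
apply: (@le_trans _ _ (j * 2 ^ m)%:R); last by rewrite ler_nat -kE leq_addr.
by rewrite natrM natrX ler_pM2l.
Qed.
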